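(* Let $\mathfrak{g}$ be a real Lie algebra of dimension two or three. If $\mathfrak{g}$ can be endowed with an ad-invariant metric, then \begin{itemize} \item in dimension two, $\mathfrak{g}$ is abelian, and \item in dimension three, $\mathfrak{g}$ is abelian or simple. \end{itemize}
   Context: An ad-invariant metric on a real Lie algebra $\mathfrak{g}$ is a non-degenerate symmetric bilinear form $\langle\,,\,\rangle$ on $\mathfrak{g}$ (of any signature) such that $\langle [X,Y],Z\rangle+\langle Y,[X,Z]\rangle=0$ for all $X,Y,Z\in\mathfrak{g}$. *)

(* Defs.v *)
From HB Require Import structures.
From mathcomp Require Import all_boot all_order all_algebra.
From mathcomp Require Import reals.

Set Implicit Arguments.
Unset Strict Implicit.
Unset Printing Implicit Defensive.

Import Order.TTheory GRing.Theory Num.Theory.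

Local Open Scope ring_scope.

HB.mixin Record Vector_isLieAlgebra (K : fieldType) (g : Type)
    of Vector K g := {
  lie_bracket : g -> g -> g;
  lie_bracket_bilinear : bilinear_for *:%R *:%R lie_bracket;
  lie_bracketxx : forall x, lie_bracket x x = 0;
  lie_jacobi : forall x y z,
    lie_bracket x (lie_bracket y z) + lie_bracket y (lie_bracket z x)
      + lie_bracket z (lie_bracket x y) = 0
}.

#[short(type="lieAlgebraType")]
HB.structure Definition LieAlgebra (K : fieldType) :=
  {g of Vector_isLieAlgebra K g & Vector K g}.

Notation "[lie x , y ]" := (lie_bracket x y)
  (at level 0, x at level 99, y at level 99, format "[lie  x ,  y ]")
  : ring_scope.

HB.instance Definition _ (K : fieldType) (g : lieAlgebraType K) :=
  bilinear_isBilinear.Build K g g g *:%R *:%R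
    (@lie_bracket K g) lie_bracket_bilinear.

Definition lie_abelian (K : fieldType) (g : lieAlgebraType K) : Prop :=
  forall x y : g, [lie x, y] = 0.

Definition lie_ideal (K : fieldType) (g : lieAlgebraType K)
    (I : {vspace g}) : Prop :=
  forall x y : g, y \in I -> [lie x, y] \in I.

(* Non-abelian is required, so the one-dimensional algebra is not simple. *)
Definition lie_simple (K : fieldType) (g : lieAlgebraType K) : Prop :=
  ~ lie_abelian g /\
  forall I : {vspace g}, lie_ideal I -> I = 0%VS \/ I = fullv.

(* Indefinite signature is allowed: only the radical is required to be 0. *)
Definition ad_invariant_metric (K : fieldType) (g : lieAlgebraType K)
    (B : {symmetric g}) : Prop :=
  nondegenerate B /\
  forall X Y Z : g, B [lie X, Y] Z + B Y [lie X, Z] = 0.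

(* Main.v *)
(** The trilinear form [<[X, Y], Z>] of an ad-invariant metric is alternating,
    so if [u, v, w] span the algebra and [<[u, v], w> = 0] then every bracket
    is orthogonal to everything, hence zero. In dimension two take [w = 0].
    In dimension three, a proper nonzero ideal [I] and its orthogonal contain
    linearly independent vectors [y] in [I] and [z] orthogonal to [I], by a
    dimension count; then [[x, y]] lies in [I], so [<[x, y], z> = 0] for a
    vector [x] completing [y, z] to a basis. *)

Require Import Defs.
From HB Require Import structures.
From mathcomp Require Import all_boot all_order all_algebra.
From mathcomp Require Import reals.

Set Implicit Arguments.
Unset Strict Implicit.
Unset Printing Implicit Defensive.

Import Order.TTheory GRing.Theory Num.Theory.

Local Open Scope ring_scope.

Lemma ltn_dimv_notin (K : fieldType) (vT : vectType K) (U V : {vspace vT}) :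
  (\dim U < \dim V)%N -> exists2 v, v \in V & v \notin U.
Proof.
move=> ltUV; apply/subvPn; apply: contraL ltUV => /dimvS.
by rewrite leqNgt.
Qed.

(** By rank-nullity, intersecting with the kernel of one more functional lowers the dimension by at
    most one, since its image lies in the line [K^o]. *)
Lemma leq_dim_bigcap_lker (K : fieldType) (vT : vectType K) (n : nat)
    (f : 'I_n -> 'Hom(vT, K^o)) :
  (\dim {:vT} <= n + \dim (\bigcap_(i < n) lker (f i))%VS)%N.
Proof.
elim: n f => [|n IHn] f; first by rewrite big_ord0.
rewrite big_ord_recr /= addSnnS; apply: leq_trans (IHn (fun i => f (widen_ord (leqnSn n) i))) _.
rewrite leq_add2l; set V := bigop _ _ _.
rewrite -(limg_ker_dim (f ord_max) V) addnC -addn1 addnC leq_add2l.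
by rewrite (leq_trans (dimvS (subvf _))) // dimvf.
Qed.

Lemma leq_dim_orthov (K : fieldType) (vT : vectType K) (B : {symmetric vT})
    (V : {vspace vT}) :
  (\dim {:vT} <= \dim V + \dim (orthov B V))%N.
(* [orthov B V] is by definition the intersection of [\dim V] kernels, one for each vector of a
   basis of [V]. *)
Proof. exact: leq_dim_bigcap_lker. Qed.

(** One of the two spaces has dimension at least two, so it is not contained in a line spanned by a
    nonzero vector of the other. *)
Lemma free_pair_dimv (K : fieldType) (vT : vectType K) (U V : {vspace vT}) :
  U != 0%VS -> V != 0%VS -> (2 < \dim U + \dim V)%N ->
  exists u v, [/\ u \in U, v \in V & free [:: u; v]].
Proof.
wlog: U V / (1 < \dim V)%N => [wlogV U0 V0 dimUV|dimV U0 _ _].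
  have [dimV|dimV] := ltnP 1 (\dim V); first exact: wlogV.
  have dimU : (1 < \dim U)%N.
    rewrite ltnNge; apply: contraL dimUV => dimU; rewrite -leqNgt.
    exact: leq_add dimU dimV.
  have [|v [u [vV uU freevu]]] := wlogV V U dimU V0 U0; first by rewrite addnC.
  by exists u, v; split; rewrite // (perm_free (_ : perm_eq _ [:: v; u])) // (perm_catC [:: u]).
have u0 : vpick U != 0 by rewrite vpick0.
have [|v vV vNu] := @ltn_dimv_notin _ _ <[vpick U]>%VS V.
  by rewrite dim_vline u0.
exists (vpick U), v; split=> //; first exact: memv_pick.
(* [free_cons] tests the head against the span of the tail, so [v] is moved to the front. *)
rewrite (perm_free (_ : perm_eq _ [:: v; vpick U])); last first.
  by rewrite (perm_catC [:: _]).
by rewrite free_cons span_seq1 vNu seq1_free.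
Qed.

Section AdInvariantMetric.

Variables (K : fieldType) (g : lieAlgebraType K) (B : {symmetric g}).
Hypothesis metricB : ad_invariant_metric B.

Lemma lie_bracketC (x y : g) : [lie x, y] = - [lie y, x].
Proof.
apply/eqP; rewrite -addr_eq0; have := lie_bracketxx (x + y).
by rewrite linearDl !linearD /= !lie_bracketxx add0r addr0 => ->.
Qed.

Lemma formC (x y : g) : B x y = B y x.
Proof. by rewrite hermC /= expr0 mul1r. Qed.

(** Ad-invariance moves the bracket across the form; with the two antisymmetries this is cyclic
    invariance, from which alternation follows. *)
Lemma form_lie_rot (x y z : g) : B [lie x, y] z = B [lie y, z] x.
Proof.
have /eqP := metricB.2 y x z; rewrite addr_eq0 => /eqP Byx.
by rewrite lie_bracketC linearNl /= Byx opprK formC.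
Qed.

Lemma form_liexx (x y : g) : B [lie x, y] y = 0.
Proof. by rewrite form_lie_rot lie_bracketxx linear0l. Qed.

Lemma form_liexy (x y : g) : B [lie x, y] x = 0.
Proof. by rewrite -form_lie_rot lie_bracketxx linear0l. Qed.

Lemma span3_lie_abelian (u v w : g) :
  <<[:: u; v; w]>>%VS = fullv -> B [lie u, v] w = 0 -> lie_abelian g.
Proof.
rewrite !span_cons span_nil addv0 => spang uvw0.
(* Nondegeneracy says that the orthogonal of [fullv] is zero; as [fullv] is a sum of three lines,
   three pairings decide whether a bracket vanishes. *)
have lie0 (x y : g) : B [lie x, y] u = 0 -> B [lie x, y] v = 0 ->
    B [lie x, y] w = 0 -> [lie x, y] = 0.
  move=> Bu Bv Bw; apply/eqP; rewrite -memv0 -(eqP metricB.1) -spang memvE.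
  by rewrite !orthovD !orthov11 Bu Bv Bw eqxx.
have uv0 : [lie u, v] = 0 by apply: lie0; rewrite ?form_liexx ?form_liexy.
have vw0 : [lie v, w] = 0.
  by apply: lie0; rewrite ?form_liexx ?form_liexy // -form_lie_rot.
have uw0 : [lie u, w] = 0.
  apply: lie0; rewrite ?form_liexx ?form_liexy // form_lie_rot.
  by rewrite lie_bracketC vw0 oppr0 linear0l.
have decomp (x : g) : exists a b c, x = a *: u + (b *: v + c *: w).
  have : x \in fullv by exact: memvf.
  rewrite -spang => /memv_addP[_ /vlineP[a ->] [t + ->]].
  by move=> /memv_addP[_ /vlineP[b ->] [_ /vlineP[c ->] ->]]; exists a, b, c.
move=> x y; have [a [b [c ->]]] := decomp x; have [a' [b' [c' ->]]] := decomp y.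
rewrite !(linearDl, linearD, linearZ) /= !linearZl_LR /= !lie_bracketxx.
rewrite (lie_bracketC v u) (lie_bracketC w u) (lie_bracketC w v).
by rewrite uv0 uw0 vw0 !(oppr0, scaler0, addr0).
Qed.

Lemma dim2_lie_abelian : \dim {:g} = 2%N -> lie_abelian g.
Proof.
move=> dimg; have := vbasisP {:g}; move: (vbasis _); rewrite dimg => b.
case/tupleP: b => u b; case/tupleP: b => v b; rewrite (tuple0 b) => /span_basis.
rewrite /= => spang; apply: (@span3_lie_abelian u v 0); last exact: linear0r.
by rewrite -spang !span_cons span_nil !addv0.
Qed.

Lemma dim3_ideal_lie_abelian (I : {vspace g}) :
  \dim {:g} = 3%N -> lie_ideal I -> I != 0%VS -> I != fullv -> lie_abelian g.
Proof.
move=> dimg idI I0 If.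
have dimI : (\dim I < 3)%N.
  by rewrite -dimg ltnNge; apply: contra If => ?; rewrite eqEdim subvf.
have := leq_dim_orthov B I; rewrite dimg => dimIo.
(* A zero orthogonal would force [\dim I] to be at least 3. *)
have Io0 : orthov B I != 0%VS.
  by apply: contraTneq dimIo => ->; rewrite dimv0 addn0 -ltnNge.
have [y [z [yI zIo freeyz]]] := free_pair_dimv I0 Io0 dimIo.
have [|x _ xNyz] := @ltn_dimv_notin _ _ <<[:: y; z]>>%VS fullv.
  by rewrite dimg ltnS dim_span.
have freexyz : free [:: x; y; z] by rewrite free_cons xNyz.
apply: (@span3_lie_abelian x y z).
  by apply/eqP; rewrite eqEdim subvf (eqnP freexyz) dimg.
by rewrite formC; apply: (mem_orthovP zIo); apply: idI.
Qed.

End AdInvariantMetric.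

Theorem proposition2p3 (R : realType) (g : lieAlgebraType R)
    (dim_g : \dim {:g} = 2%N \/ \dim {:g} = 3%N)
    (metric_g : exists B : {symmetric g}, ad_invariant_metric B) :
  (\dim {:g} = 2%N -> lie_abelian g) /\
  (\dim {:g} = 3%N -> lie_abelian g \/ lie_simple g).
Proof.
have [B metricB] := metric_g; split; first exact: dim2_lie_abelian metricB.
(* Classical case split: non-abelianness is half of simplicity, and it also rules out proper nonzero
   ideals. *)
move=> dim3; case: (boolp.pselect (lie_abelian g)) => [|nab]; first by left.
right; split=> // I idI.
have [->|I0] := eqVneq I 0%VS; first by left.
have [->|If] := eqVneq I fullv; first by right.
by case: nab; apply: dim3_ideal_lie_abelian metricB _ dim3 idI I0 If.
Qed.
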